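(* Let $E\in F^{L\times n}$ be an error pattern and let $r_E$ be the rank of $E$ as a matrix over $F$. If $$|U_E|\le\frac{n-k_{\max}+r_E-1}{2},$$ then $E$ satisfies the partial-inverse condition.
   Context: For polynomials, $\bmod$ denotes the remainder of polynomial division; the degree of the zero polynomial is $-\infty$. Setting: $F$ is a finite field, $L\ge1$, $\beta_0,\ldots,\beta_{n-1}$ are $n$ distinct elements of $F$ (one may be $0$), $m(x):=\prod_{\ell=0}^{n-1}(x-\beta_\ell)$, and $\psi:F[x]/m(x)\to F^n$, $a(x)\mapsto(a(\beta_0),\ldots,a(\beta_{n-1}))$, a ring isomorphism; $\psi^{-1}(v)$ is identified with the unique polynomial of degree less than $n$ whose values at $\beta_0,\ldots,\beta_{n-1}$ are the entries of $v$. The interleaved Reed--Solomon code consists of the arrays in $F^{L\times n}$ whose $i$-th row $c^{(i)}$ satisfies $\deg\psi^{-1}(c^{(i)})<k^{(i)}$, where $k^{(i)}$ is the dimension of the $i$-th row code, $i=1,\ldots,L$. Let $k_{\max}:=\max_i k^{(i)}$; it is assumed that $k_{\max}<n$. For $E\in F^{L\times n}$ with rows $e^{(i)}$ and columns $e_0,\ldots,e_{n-1}$, put $E^{(i)}(x):=\psi^{-1}(e^{(i)})$, $U_E:=\{\ell:e_\ell\ne0\}$ and $\Lambda_E(x):=\prod_{\ell\in U_E}(x-\beta_\ell)$. SPI solution: a finite set of inequalities $\deg(b^{(i)}(x)\Lambda(x)\bmod m^{(i)}(x))<\tau^{(i)}$, $i=1,\ldots,L$ (with $\deg m^{(i)}\ge1$,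 $\deg b^{(i)}<\deg m^{(i)}$, $0\le\tau^{(i)}\le\deg m^{(i)}$), has an SPI solution, namely the nonzero polynomial $\Lambda(x)$ of smallest degree satisfying all of them; it exists and is unique up to a nonzero scale factor. Partial-inverse condition: $E$ satisfies it if $|U_E|\le n-k_{\max}$ and the SPI solution of $\deg(E^{(i)}(x)\Lambda(x)\bmod m(x))<k^{(i)}+|U_E|$, $i=1,\ldots,L$, is $\Lambda_E(x)$ (up to a nonzero scale factor). *)

(* Defs.v *)
From mathcomp Require Import all_boot all_order all_algebra.

Set Implicit Arguments.
Unset Strict Implicit.
Unset Printing Implicit Defensive.

Import Order.TTheory GRing.Theory Num.Theory.
Local Open Scope ring_scope.

(* Throughout, "deg p < d" is written [size p <= d]: since [size 0 = 0], this
   agrees with the convention that the zero polynomial has degree -oo. *)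

Section Evaluation.
Variables (F : finFieldType) (n : nat) (beta : 'I_n -> F).

Definition m_poly : {poly F} := \prod_(l < n) ('X - (beta l)%:P).

Definition psi (a : {poly F}) : 'rV[F]_n := \row_l a.[beta l].

(* The inverse of [psi] on polynomials of degree < n, by Lagrange
   interpolation; meaningful for injective [beta], see [psi_invK], [psiK].
   The library's [lagrange] needs an injective [nat -> F], so it cannot be
   used over a finite field. *)
Definition psi_inv (v : 'rV[F]_n) : {poly F} :=
  \sum_(l < n) v 0 l *:
    \prod_(j < n | j != l) ((beta l - beta j)^-1 *: ('X - (beta j)%:P)).

Lemma size_psi_inv v : (size (psi_inv v) <= n)%N.
Proof.
apply: (leq_trans (size_sum _ _ _)); apply/bigmax_leqP => l _.
apply: (leq_trans (size_scale_leq _ _)); rewrite scaler_prod.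
apply: (leq_trans (size_scale_leq _ _)).
rewrite -big_filter size_prod_XsubC size_filter -sum1_count sum1_card.
by rewrite cardC1 card_ord prednK // (leq_ltn_trans _ (ltn_ord l)).
Qed.

Hypothesis beta_inj : injective beta.

Lemma psi_invK v : psi (psi_inv v) = v.
Proof.
apply/rowP => i; rewrite mxE horner_sum (bigD1 i) //= hornerZ horner_prod.
rewrite big1 ?mulr1 => [|j ji]; last first.
  by rewrite hornerZ hornerXsubC mulVf // subr_eq0 (inj_eq beta_inj) eq_sym.
rewrite big1 ?addr0 // => l li; rewrite hornerZ horner_prod (bigD1 i) 1?eq_sym //=.
by rewrite hornerZ hornerXsubC subrr mulr0 mul0r mulr0.
Qed.

Lemma psiK (p : {poly F}) : (size p <= n)%N -> psi_inv (psi p) = p.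
Proof.
move=> sp; apply/eqP; rewrite -subr_eq0; apply/eqP.
apply: (@roots_geq_poly_eq0 _ _ [seq beta l | l <- enum 'I_n]).
- apply/allP => _ /mapP[l _ ->]; rewrite rootE hornerD hornerN subr_eq0.
  by have /rowP/(_ l) := psi_invK (psi p); rewrite !mxE => ->.
- by rewrite map_inj_uniq ?enum_uniq.
rewrite size_map -cardE card_ord (leq_trans (size_polyD _ _)) // geq_max.
by rewrite size_psi_inv size_polyN.
Qed.

End Evaluation.

Section SPI.
Variables (F : fieldType) (L : nat).
Variables (b m : 'I_L -> {poly F}) (tau : 'I_L -> nat).

Definition SPI_ineqs (Lam : {poly F}) : Prop :=
  forall i, (size ((b i * Lam) %% m i)%R <= tau i)%N.

Definition SPI_solution (Lam : {poly F}) : Prop :=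
  [/\ Lam != 0, SPI_ineqs Lam &
      forall Lam' : {poly F}, Lam' != 0 -> SPI_ineqs Lam' ->
        (size Lam <= size Lam')%N].

End SPI.

Section ErrorPattern.
Variables (F : finFieldType) (L n : nat) (beta : 'I_n -> F) (k : 'I_L -> nat).

Definition k_max : nat := \max_(i < L) k i.

Variable E : 'M[F]_(L, n).

Definition E_poly (i : 'I_L) : {poly F} := psi_inv beta (row i E).

Definition err_supp : {set 'I_n} := [set l | col l E != 0].

Definition err_loc : {poly F} := \prod_(l in err_supp) ('X - (beta l)%:P).

(* [p %= q] means that p and q agree up to a nonzero scalar factor. The
   equivalence says both that [err_loc] is an SPI solution and that it is the
   only one up to such a factor. *)
Definition partial_inverse_condition : Prop :=
  (#|err_supp| <= n - k_max)%N /\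
  forall Lam : {poly F},
    SPI_solution E_poly (fun=> m_poly beta) (fun i => k i + #|err_supp|)%N Lam
    <-> Lam %= err_loc.

End ErrorPattern.

(* Main.v *)
Require Import Defs.
From mathcomp Require Import all_boot all_order all_algebra.
From mathcomp Require Import zify lra.
Import Order.TTheory GRing.Theory Num.Theory.
Local Open Scope ring_scope.

(** Any nonzero Lambda satisfying the inequalities is a multiple of Lambda_E.
    Let A be E with column l scaled by Lambda(beta_l), let r, rho be the ranks
    of E, A and t, s their numbers of nonzero columns; splitting E into the
    columns which survive in A and the others gives r <= rho + (t - s). If
    s > 0, solving on rho independent columns of A yields a nonzero vector u A
    which vanishes on rho - 1 nonzero columns of A, and on all n - s zero ones.
    But u A is the evaluation of a polynomial of degree < k_max + t, so
    n - s + rho - 1 < k_max + t, contradicting the bound on t. Hence s = 0,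
    that is, Lambda vanishes on the whole support of E. *)

Section ColumnSupport.
Set Implicit Arguments.
Unset Strict Implicit.
Variables (F : finFieldType) (L n : nat).
Implicit Types A : 'M[F]_(L, n).

Lemma in_err_supp A l : (l \in err_supp A) = (col l A != 0).
Proof. by rewrite inE. Qed.

Lemma err_supp_mulmx A (u : 'rV[F]_L) l : (u *m A) 0 l != 0 -> l \in err_supp A.
Proof.
rewrite in_err_supp; apply: contraNneq => A0; rewrite mxE big1 // => i _.
by have /colP/(_ i) := A0; rewrite !mxE => ->; rewrite mulr0.
Qed.

Lemma entry_notin_err_supp A i l : l \notin err_supp A -> A i l = 0.
Proof. by rewrite in_err_supp negbK => /eqP/colP/(_ i); rewrite !mxE. Qed.

(** The columns picked by [f] form a basis of the column space, so the submatrix they form has a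
    left inverse [B]; row [j] of [B] is the wanted [u]. *)
Lemma dual_columns A : exists2 f : 'I_(\rank A) -> 'I_n, injective f &
  forall j, exists u : 'rV[F]_L, forall i, (u *m A) 0 (f i) = (i == j)%:R.
Proof.
rewrite -mxrank_tr; exists (maxrankfun A^T); first exact: maxrankfun_inj.
set f := maxrankfun _ => j.
have : row_full (colsub f A).
  by rewrite /row_full -mxrank_tr trmx_mxsub; exact: maxrowsub_free.
case/row_fullP => B BA; exists (row j B) => i.
have := congr1 (fun M => row j M 0 i) BA; rewrite row_mul !mxE eq_sym => <-.
by apply: eq_bigr => x _; rewrite !mxE.
Qed.

Lemma mxrank_le_err_supp A : (\rank A <= #|err_supp A|)%N.
Proof.
have [f f_inj fP] := dual_columns A.
rewrite -[X in (X <= _)%N]card_ord -(card_imset _ f_inj).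
apply/subset_leq_card/subsetP => _ /imsetP[j _ ->].
have [u uP] := fP j; apply: (@err_supp_mulmx _ u).
by rewrite uP eqxx oner_neq0.
Qed.

Lemma low_weight_row A : A != 0 -> exists2 u : 'rV[F]_L, u *m A != 0 &
  (n + \rank A <= #|[set l | (u *m A) 0%R l == 0%R]| + #|err_supp A| + 1)%N.
Proof.
rewrite -mxrank_eq0 -lt0n => A_gt0; have [f f_inj fP] := dual_columns A.
pose j := Ordinal A_gt0; have [u uP] := fP j; exists u.
  by apply/rV0Pn; exists (f j); rewrite uP eqxx oner_neq0.
(* [J] consists of the other basis columns: they lie in the support of [A], yet [u *m A] vanishes
   there, so these zeros are disjoint from those at the zero columns of [A]. *)
pose J := f @: [set~ j].
have cJ : #|J| = (\rank A).-1 by rewrite card_imset // cardsC1 card_ord.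
have Jsupp : J \subset err_supp A.
  apply/subsetP => _ /imsetP[i _ ->]; have [v vP] := fP i.
  by apply: (@err_supp_mulmx _ v); rewrite vP eqxx oner_neq0.
have sub : ~: err_supp A :|: J \subset [set l | (u *m A) 0%R l == 0%R].
  apply/subsetP => l; rewrite in_setU in_setC [X in _ -> is_true X]inE.
  case/orP => [|/imsetP[i]]; first by apply: contraNT; exact: err_supp_mulmx.
  by rewrite in_setC1 => /negPf ij ->; rewrite uP ij.
have := subset_leq_card sub; rewrite cardsU.
have -> : ~: err_supp A :&: J = set0.
  by apply/disjoint_setI0; rewrite disjoint_sym -subsets_disjoint.
have cC : (#|err_supp A| + #|~: err_supp A| = n)%N by rewrite cardsC card_ord.
rewrite cards0 cJ; set z := #|[set l | _]|; lia.
Qed.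

Lemma mulmx_diagE A (d : 'rV[F]_n) i l : (A *m diag_mx d) i l = A i l * d 0 l.
Proof. by rewrite mul_mx_diag mxE. Qed.

Lemma in_err_supp_diag A (d : 'rV[F]_n) l :
  (l \in err_supp (A *m diag_mx d)) = (l \in err_supp A) && (d 0 l != 0).
Proof.
have -> : (l \in err_supp (A *m diag_mx d)) = (d 0 l *: col l A != 0).
  rewrite in_err_supp; congr (_ != _); apply/colP => i.
  by rewrite mxE mulmx_diagE !mxE mulrC.
by rewrite in_err_supp scaler_eq0 negb_or andbC.
Qed.

Lemma mxrank_mul_diag A (d : 'rV[F]_n) :
  (\rank A + #|err_supp (A *m diag_mx d)|
     <= \rank (A *m diag_mx d) + #|err_supp A|)%N.
Proof.
pose AD := A *m diag_mx d.
(* Since [0^-1 = 0], [AD *m diag_mx e] restores exactly the columns of [A] where [d] is nonzero; [g]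
   is the indicator of the remaining ones. *)
pose e : 'rV[F]_n := \row_l (d 0 l)^-1.
pose g : 'rV[F]_n := \row_l (d 0 l == 0)%:R.
have AE : A = AD *m diag_mx e + A *m diag_mx g.
  apply/matrixP => i l; rewrite mxE !mulmx_diagE !mxE -mulrA -mulrDr.
  have [->|d0] := eqVneq; first by rewrite mul0r add0r mulr1.
  by rewrite divff // addr0 mulr1.
have rA : (\rank A <= \rank AD + #|err_supp (A *m diag_mx g)|)%N.
  rewrite {1}AE (leq_trans (mxrank_add _ _)) // leq_add ?mxrankM_maxl //.
  exact: mxrank_le_err_supp.
suff -> : #|err_supp A| = (#|err_supp AD| + #|err_supp (A *m diag_mx g)|)%N.
  by rewrite addnCA addnC leq_add2l.
rewrite -(cardsID (err_supp AD) (err_supp A)); congr (_ + _)%N; apply: eq_card => l.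
  by rewrite in_setI !in_err_supp_diag; case: (_ \in _).
rewrite in_setD !in_err_supp_diag mxE.
by case: (l \in _); case: eqP; rewrite /= ?oner_eq0 ?eqxx.
Qed.

End ColumnSupport.

Section ErrorLocator.
Set Implicit Arguments.
Unset Strict Implicit.
Variables (F : finFieldType) (L n : nat) (beta : 'I_n -> F) (k : 'I_L -> nat).
Variable E : 'M[F]_(L, n).
Hypothesis beta_inj : injective beta.

Let ineqs := SPI_ineqs (E_poly beta E) (fun=> m_poly beta)
  (fun i => k i + #|err_supp E|)%N.

Lemma horner_m_poly l : (m_poly beta).[beta l] = 0.
Proof. by rewrite horner_prod (bigD1 l) //= hornerXsubC subrr mul0r. Qed.

Lemma horner_modp_m_poly p l : (p %% m_poly beta).[beta l] = p.[beta l].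
Proof. by rewrite [in RHS](divp_eq p (m_poly beta)) !hornerE horner_m_poly mulr0 add0r. Qed.

Lemma dvdp_prod_XsubC (A : {set 'I_n}) p :
  (\prod_(l in A) ('X - (beta l)%:P) %| p) = [forall l in A, root p (beta l)].
Proof.
apply/idP/forall_inP => [dv l lA|rp].
  by rewrite -dvdp_XsubCl; apply: dvdp_trans dv; rewrite (bigD1 l) //= dvdp_mulIl.
rewrite -big_enum /= -(big_map beta predT (fun a => 'X - a%:P)).
apply: uniq_roots_dvdp.
  by apply/allP => _ /mapP[l lA ->]; apply: rp; rewrite -mem_enum.
by rewrite uniq_rootsE map_inj_uniq ?enum_uniq.
Qed.

Lemma horner_E_poly i l : (E_poly beta E i).[beta l] = E i l.
Proof. by have /rowP/(_ l) := psi_invK beta_inj (row i E); rewrite !mxE. Qed.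

(** At each [beta l] either [Lam] vanishes (on the support) or every [E_poly] does (off it), so all
    the remainders are 0. *)
Lemma ineqs_dvdp Lam : err_loc beta E %| Lam -> ineqs Lam.
Proof.
rewrite dvdp_prod_XsubC => /forall_inP Lam0 i.
suff /modp_eq0P -> : m_poly beta %| E_poly beta E i * Lam by rewrite size_poly0.
rewrite /m_poly -(eq_bigl _ _ (fun l => in_setT l)) dvdp_prod_XsubC.
apply/forall_inP => l _; rewrite rootE hornerM horner_E_poly.
have [/Lam0/eqP->|/entry_notin_err_supp->] := boolP (l \in err_supp E).
  by rewrite mulr0.
by rewrite mul0r.
Qed.

Lemma dvdp_ineqs Lam :
  (2 * #|err_supp E| + k_max k < n + \rank E)%N -> ineqs Lam ->
  err_loc beta E %| Lam.
Proof.
move=> bound Lam_ineqs; pose A := E *m diag_mx (psi beta Lam).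
have [A0|A_neq0] := eqVneq A 0.
  rewrite dvdp_prod_XsubC; apply/forall_inP => l lE; rewrite rootE.
  have := in_err_supp_diag E (psi beta Lam) l; rewrite -/A A0 lE mxE /=.
  by rewrite in_err_supp col0 eqxx => /esym/negbFE.
have [u uA_neq0 uA_zeros] := low_weight_row A_neq0.
(* Reduction modulo [m_poly] keeps the values at the points [beta l], so [c] evaluates to [u *m A],
   while each remainder obeys the degree bound of the inequalities. *)
pose c := \sum_i u 0 i *: ((E_poly beta E i * Lam) %% m_poly beta).
have cE l : c.[beta l] = (u *m A) 0 l.
  rewrite horner_sum mxE; apply: eq_bigr => i _.
  by rewrite hornerZ horner_modp_m_poly hornerM horner_E_poly mulmx_diagE mxE.
have c_neq0 : c != 0.
  apply: contraNneq uA_neq0 => c0; apply/eqP/rowP => l.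
  by rewrite -cE c0 horner0 mxE.
have size_c : (size c <= k_max k + #|err_supp E|)%N.
  apply: (leq_trans (size_sum _ _ _)); apply/bigmax_leqP => i _.
  apply: (leq_trans (size_scale_leq _ _)); apply: (leq_trans (Lam_ineqs i)).
  by rewrite leq_add2r leq_bigmax.
have zeros_lt : (#|[set l | (u *m A) 0%R l == 0%R]| < size c)%N.
  rewrite cardE -(size_map beta); apply: max_poly_roots => //.
    by apply/allP => _ /mapP[l lZ ->]; move: lZ; rewrite mem_enum inE -cE.
  by rewrite map_inj_uniq ?enum_uniq.
(* With t, s, r, rho as above, the root count gives n + rho <= k_max + t + s. Adding r + s <= rho +
   t cancels s and rho and leaves n + r <= k_max + 2t, against [bound]. *)
have := mxrank_mul_diag E (psi beta Lam); rewrite -/A; lia.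
Qed.

End ErrorLocator.

Theorem theorem4 (F : finFieldType) (L n : nat) (beta : 'I_n -> F)
    (k : 'I_L -> nat) (E : 'M[F]_(L, n)) :
  (0 < L)%N -> injective beta -> (k_max k < n)%N ->
  (#|err_supp E|%:R <=
     (n%:R - (k_max k)%:R + (\rank E)%:R - 1) / 2%:R :> rat) ->
  partial_inverse_condition beta k E.
Proof.
move=> _ beta_inj _ boundQ.
(* Over the naturals the -1 in the numerator becomes strictness. *)
have bound : (2 * #|err_supp E| + k_max k < n + \rank E)%N.
  rewrite -(ltr_nat rat) natrD natrM natrD; lra.
(* Here r <= t turns 2t + k_max < n + r into t + k_max < n. *)
split; first by have := mxrank_le_err_supp E; lia.
have loc_neq0 : err_loc beta E != 0.
  by rewrite monic_neq0 ?monic_prod // => l _; exact: monicXsubC.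
move=> Lam; split => [[Lam_neq0 Lam_ineqs Lam_min]|Lam_loc].
  (* [err_loc] divides [Lam] and itself satisfies the inequalities, so minimality of [Lam] forces
     equal degrees. *)
  rewrite eqp_sym -dvdp_size_eqp; last exact: dvdp_ineqs Lam_ineqs.
  have loc_dvd := dvdp_ineqs beta_inj bound Lam_ineqs.
  by rewrite eqn_leq dvdp_leq //= Lam_min //; exact: ineqs_dvdp.
split=> [||Lam' Lam'_neq0 Lam'_ineqs].
- by rewrite -size_poly_eq0 (eqp_size Lam_loc) size_poly_eq0.
- by apply: ineqs_dvdp; rewrite // (eqp_dvdr _ Lam_loc).
by rewrite (eqp_size Lam_loc) dvdp_leq //; exact: dvdp_ineqs Lam'_ineqs.
Qed.
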